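(* Let $\mathcal{X}=X_1\times\dots\times X_d$, where $X_1,\dots,X_p$ are Suslin spaces and $X_{p+1},\dots,X_d$ are real intervals, let $a_i\in X_i$ for $p<i\le d$, and let $\varphi_i^{(j)}:X_i\to\mathbb{R}$ ($1\le j\le N_i$, $1\le i\le d$) be measurable functions. Let $\mathcal{A}_i$ and $\Delta_i(N_i)$ be the associated (unimodal) moment classes and sets of finite mixtures defined in the context, and let $\mathcal{A}=\prod_{i=1}^d\mathcal{A}_i$, $\Delta=\prod_{i=1}^d\Delta_i(N_i)$. Suppose that the integral representation property holds on every $\mathcal{A}_i$: every $\mu_i\in\mathcal{A}_i$ is the barycenter of some probability measure supported on $\Delta_i(N_i)$. Then every measure in $\mathcal{A}$ is the barycenter of a probability measure supported on $\Delta$.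
   Context: A Suslin space is the image of a Polish space under a continuous mapping. $\mathcal{P}(X)$ is the set of Borel probability measures on $X$, with the weak topology induced by $C_b(X)$ (bounded continuous real functions). A constraint $\mathbb{E}_\mu[\varphi]\le 0$ is understood to include that $\varphi$ is $\mu$-integrable. For an interval $X\subset\mathbb{R}$ and $a\in X$, a probability measure $\mu$ on $X$ with distribution function $F_\mu$ is unimodal with mode $a$ if $F_\mu$ is convex on $]-\infty,a[$ and concave on $]a,+\infty[$; $\mathcal{H}_a(X)$ is the set of all such measures. $\mathcal{U}_a(X)$ is the set of uniform probability measures on the intervals $\mathrm{co}(a,z)$ (convex hull of $\{a,z\}$), $z\in X$, including the Dirac mass at $a$. The classes are - $\mathcal{A}_i=\{\mu_i\in\mathcal{P}(X_i): \mathbb{E}_{\mu_i}[\varphi_i^{(j)}]\le 0,\ 1\le j\le N_i\}$ and $\Delta_i(N_i)=\{\mu_i\in\mathcal{A}_i:\mu_i=\sum_{k=1}^{N_i+1}\omega_k\delta_{x_k},\ \omega_k\ge 0,\ x_k\in X_i\}$ for $1\le i\le p$; - $\mathcal{A}_i=\{\mu_i\in\mathcal{H}_{a_i}(X_i): \mathbb{E}_{\mu_i}[\varphi_i^{(j)}]\le 0,\ 1\le j\le N_i\}$ and $\Delta_i(N_i)=\{\mu_i\in\mathcal{A}_i:\mu_i=\sum_{k=1}^{N_i+1}\omega_k\mathfrak{u}_k,\ \omega_k\ge 0,\ \mathfrak{u}_k\in\mathcal{U}_{a_i}(X_i)\}$ for $p<i\le d$. A tuple $(\mu_1,\dots,\mu_d)\in\mathcal{A}$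 is identified with the product measure $\mu_1\otimes\dots\otimes\mu_d$ on $\mathcal{X}$, so elements of $\Delta$ are product measures $s=s_1\otimes\dots\otimes s_d$ with $s_i\in\Delta_i(N_i)$; $\Delta$ carries the product $\sigma$-algebra. ''$\mu_i$ is the barycenter of $\boldsymbol{\nu}_i$'' means $\int_{X_i}\phi\,d\mu_i=\int_{\Delta_i(N_i)}\big(\int_{X_i}\phi\,ds\big)d\boldsymbol{\nu}_i(s)$ for all $\phi\in C_b(X_i)$; likewise ''$\mu\in\mathcal{A}$ is the barycenter of $\boldsymbol{\nu}$'' (with $\boldsymbol\nu$ a probability measure on $\Delta$) means $\int_{\mathcal{X}}\phi\,d\mu=\int_{\Delta}\big(\int_{\mathcal{X}}\phi\,ds\big)d\boldsymbol{\nu}(s)$ for all $\phi\in C_b(\mathcal{X})$. *)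

(* Defs.v *)
From HB Require Import structures.
From mathcomp Require Import all_boot all_order all_algebra.
From mathcomp Require Import all_classical all_reals all_analysis.

Set Implicit Arguments.
Unset Strict Implicit.
Unset Printing Implicit Defensive.

Import Order.TTheory GRing.Theory Num.Theory.
Import numFieldNormedType.Exports.

Local Open Scope classical_set_scope.
Local Open Scope ring_scope.

(* The carrier [T] with base point [x].  The measurable types of the library
   are pointed; this alias supplies the point for subspaces. *)
Definition based (T : topologicalType) (x : T) : Type := T.

HB.instance Definition _ (T : topologicalType) (x : T) :=
  Topological.on (based x).
HB.instance Definition _ (T : topologicalType) (x : T) :=
  isPointed.Build (based x) x.

(* [T] with its Borel sigma-algebra. *)
Definition borel (T : ptopologicalType) := g_sigma_algebraType (@open T).
HB.instance Definition _ (T : ptopologicalType) := Measurable.on (borel T).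

(* Continuous image of a Polish space, a Polish space being given with a
   complete metric inducing its topology (a pseudometric whose topology is
   Hausdorff is a metric).  No separation axiom is imposed on the image. *)
Definition suslin (R : realType) (T : topologicalType) : Prop :=
  exists (P : completePseudoMetricType R) (f : P -> T),
    [/\ hausdorff_space P,
        exists2 D : set P, countable D & dense D,
        continuous f
      & range f = setT].

Definition Cb (R : realType) (T : topologicalType) : set (T -> R) :=
  [set f | continuous f /\ bounded_fun f].
Arguments Cb : clear implicits.

(* Borel probability measures on [T] with the weak topology: the coarsest one
   making [mu |-> \int[mu]_x f x] continuous for every [f] in [Cb R T].  Two
   records that agree on Borel sets but not on arbitrary sets denote the same
   measure and are topologically indistinguishable here. *)
Definition prob_ev (R : realType) (T : ptopologicalType)
    (mu : probability (borel T) R) : {ptws set_type (Cb R T) -> R} :=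
  fun f => (\int[mu]_x (set_val f) x)%R.

Definition prob (R : realType) (T : ptopologicalType) : Type :=
  initial_topology (@prob_ev R T).
Arguments prob : clear implicits.
HB.instance Definition _ (R : realType) (T : ptopologicalType) :=
  Topological.on (prob R T).

(* [mu] is the barycenter of [nu], a law on a space [S] of measures on [E]
   (embedded by [kappa]), tested against the functions in [C]. *)
Definition barycenter d d' (E : measurableType d) (S : measurableType d')
    (R : realType) (mu : probability E R) (nu : probability S R)
    (kappa : S -> probability E R) (C : set (E -> R)) : Prop :=
  forall f, C f ->
    (\int[mu]_x (f x)%:E = \int[nu]_s \int[kappa s]_x (f x)%:E)%E.

Section finite_product.
Context (I : finType) (d : I -> measure_display)
        (T : forall i, measurableType (d i)).

Definition cylinders : set (set (forall i, T i)) :=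
  [set C | exists i (B : set (T i)), measurable B /\ C = [set x | B (x i)]].

Definition mprod := g_sigma_algebraType cylinders.
HB.instance Definition _ := Measurable.on mprod.

Definition mprod_upd (i : I) (xt : mprod * T i) : mprod := dfwith xt.1 i xt.2.

Lemma measurable_mprod_upd i : measurable_fun setT (@mprod_upd i).
Proof.
apply: (@measurability _ _ _ mprod _ _ cylinders) => //.
move=> _ [_ [j [B [mB ->]]] <-]; rewrite setTI.
have [ji|ji] := eqVneq i j.
  subst j; rewrite (_ : _ @^-1` _ = setT `*` B); first exact: measurableX.
  apply/seteqP; split=> -[x t] /=; rewrite /mprod_upd dfwithin => //.
  by case.
rewrite (_ : _ @^-1` _ = [set x : mprod | B (x j)] `*` setT).
  apply: measurableX => //; apply: sub_sigma_algebra.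
  by exists j, B.
apply/seteqP; split=> -[x t] /=; rewrite /mprod_upd dfwithout //.
by case.
Qed.

HB.instance Definition _ i := isMeasurableFun.Build _ _ _ _
  (@mprod_upd i) (@measurable_mprod_upd i).

Context (R : realType) (mu : forall i, probability (T i) R).

(* The product of the [mu i]: start from a Dirac mass and resample the
   coordinates one after the other.  See [mprod_probE] for the
   characterization on boxes. *)
Definition mprod_step (i : I) (pi : probability mprod R) : probability mprod R :=
  distribution (pi \x mu i)%E (@mprod_upd i).

Definition mprod_prob : probability mprod R :=
  foldr mprod_step (dirac point : probability mprod R) (enum I).

Lemma measurable_box (B : forall i, set (T i)) :
  (forall i, measurable (B i)) ->
  measurable ([set x | forall i, B i (x i)] : set mprod).
Proof.
move=> mB.
rewrite (_ : [set x | _] = \bigcap_(i in [set: I]) [set x : mprod | B i (x i)]).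
  apply: fin_bigcap_measurable => // i _.
  by apply: sub_sigma_algebra; exists i, (B i).
by apply/seteqP; split=> x /= h i; [move=> _|]; apply: h.
Qed.

Let mprod_foldrE (s : seq I) (B : forall i, set (T i)) :
  uniq s -> (forall i, measurable (B i)) ->
  (foldr mprod_step (dirac point : probability mprod R) s
     [set x | forall i, B i (x i)] =
   (\prod_(i <- s) mu i (B i)) *
   \d_(point : mprod) [set x | forall i, i \notin s -> B i (x i)])%E.
Proof.
elim: s B => [|i s ih] B /=.
  move=> _ _; rewrite big_nil mul1e; congr (\d_ _ _).
  by apply/seteqP; split => x /= h i; [move=> _|]; apply: h.
move=> /andP[nis us] mB; rewrite big_cons.
pose B' j := if j == i then setT else B j.
have mB' j : measurable (B' j).
  by rewrite /B'; case: ifP => // _; exact: measurableT.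
rewrite /distribution /pushforward.
rewrite (_ : _ @^-1` _ = [set x | forall i, B' i (x i)] `*` B i); last first.
  apply/seteqP; split=> -[x t] /=; rewrite /mprod_upd /=.
    move=> h; split; last by have := h i; rewrite dfwithin.
    move=> j; rewrite /B'; case: eqVneq => // ji.
    by have := h j; rewrite dfwithout // eq_sym.
  move=> [h Bt] j; case: (eqVneq i j) => [ij|ij].
    by subst j; rewrite dfwithin.
  by rewrite dfwithout //; have := h j; rewrite /B' eq_sym (negbTE ij).
rewrite product_measure1E //; last exact: measurable_box.
rewrite [X in (X * _)%E](ih B') //.
rewrite muleAC [X in (X * _)%E = _]muleC; congr (_ * _ * _)%E.
  rewrite big_seq [RHS]big_seq; apply: eq_bigr => j js.
  by rewrite /B'; case: eqVneq => // ji; rewrite -ji js in nis.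
congr (\d_ _ _); apply/seteqP; split => x /= h j.
  by rewrite inE negb_or => /andP[ji /h]; rewrite /B' (negbTE ji).
by move=> js; rewrite /B'; case: eqVneq => // ji; apply: h; rewrite inE negb_or ji.
Qed.

Lemma mprod_probE (B : forall i, set (T i)) : (forall i, measurable (B i)) ->
  (mprod_prob [set x | forall i, B i (x i)] = \prod_(i : I) mu i (B i))%E.
Proof.
move=> mB; rewrite /mprod_prob mprod_foldrE ?enum_uniq // big_enum /=.
rewrite (_ : [set x | _] = setT) ?diracT ?mule1 //.
by apply/seteqP; split => x //= _ i; rewrite mem_enum.
Qed.

End finite_product.

Section classes.
Context (R : realType).

(* Integrability is part of the constraint [E_mu[phi] <= 0]. *)
Definition moment_constraints (T : ptopologicalType) (n : nat)
    (phi : 'I_n -> borel T -> R) : set (prob R T) :=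
  [set mu : probability (borel T) R | forall j,
    mu.-integrable setT (EFin \o phi j) /\ ('E_mu[phi j] <= 0)%E].

Definition mixtures (T : ptopologicalType) (n : nat)
    (G : set (probability (borel T) R)) : set (prob R T) :=
  [set mu : probability (borel T) R |
    exists (w : 'I_n -> R) (g : 'I_n -> probability (borel T) R),
      [/\ forall k, 0 <= w k,
          forall k, G (g k)
        & forall B, measurable B ->
            mu B = (\sum_(k < n) (w k)%:E * g k B)%E]].

Definition dirac_masses (T : ptopologicalType) : set (probability (borel T) R) :=
  range (fun x : borel T => dirac x : probability (borel T) R).

(* The interval [J] as a space in its own right, pointed by [a]. *)
Definition itv_space (J : interval R) (a : [set` J]) : ptopologicalType :=
  based a.

Definition cdf_itv (J : interval R) (a : [set` J])
    (mu : probability (borel (itv_space a)) R) (t : R) : R :=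
  fine (mu ((set_val : [set` J] -> R) @^-1` `]-oo, t])).

Definition unimodal (J : interval R) (a : [set` J]) :
    set (prob R (itv_space a)) :=
  [set mu : probability (borel (itv_space a)) R |
    @convex_function R R^o `]-oo, set_val a[ (cdf_itv mu) /\
    @convex_function R R^o `]set_val a, +oo[ (fun t => - cdf_itv mu t)].

(* Uniform laws on [co(a, z)] for [z] in [J], degenerate at [a] for [z = a]. *)
Definition uniform_laws (J : interval R) (a : [set` J]) :
    set (probability (borel (itv_space a)) R) :=
  [set u : probability (borel (itv_space a)) R | exists z : [set` J],
    (z = a /\ forall B, measurable B ->
       u B = dirac (a : borel (itv_space a)) B) \/
    (exists lt_az : Num.min (set_val a) (set_val z) <
                    Num.max (set_val a) (set_val z),
      forall B : set R, measurable B ->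
        u ((set_val : [set` J] -> R) @^-1` B) = uniform_prob lt_az B)].

Arguments unimodal {J} a.
Arguments uniform_laws {J} a.

Context (p q : nat) (X : 'I_p -> ptopologicalType) (J : 'I_q -> interval R)
        (a : forall k, [set` J k]).

(* The factors [X_1, ..., X_p] are indexed by [inl], and the intervals
   [X_{p+1}, ..., X_d], with [d = p + q], by [inr]. *)
Definition factor_space (i : 'I_p + 'I_q) : ptopologicalType :=
  match i with inl k => X k | inr k => itv_space (a k) end.

Context (N : 'I_p + 'I_q -> nat)
        (phi : forall i, 'I_(N i) -> borel (factor_space i) -> R).

Definition base_class (i : 'I_p + 'I_q) : set (prob R (factor_space i)) :=
  match i with inl k => setT | inr k => unimodal (a k) end.

Arguments base_class i : clear implicits.

Definition generators (i : 'I_p + 'I_q) :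
    set (probability (borel (factor_space i)) R) :=
  match i with inl k => @dirac_masses (X k) | inr k => uniform_laws (a k) end.

Arguments generators i : clear implicits.

Definition moment_class (i : 'I_p + 'I_q) : set (prob R (factor_space i)) :=
  base_class i `&` moment_constraints (@phi i).

Arguments moment_class i : clear implicits.

Definition finite_mixtures (i : 'I_p + 'I_q) : set (prob R (factor_space i)) :=
  moment_class i `&` mixtures (N i).+1 (generators i).
Arguments finite_mixtures i : clear implicits.

End classes.

Arguments factor_space {R p q} X {J} a i.
Arguments moment_class {R p q X J a N} phi i.
Arguments finite_mixtures {R p q X J a N} phi i.

(* Main.v *)
Require Import Defs.
From HB Require Import structures.
From mathcomp Require Import all_boot all_order all_algebra.
From mathcomp Require Import finmap.
From mathcomp Require Import all_classical all_reals all_analysis.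
From mathcomp Require Import giry ring.

Set Implicit Arguments.
Unset Strict Implicit.
Unset Printing Implicit Defensive.

Import Order.TTheory GRing.Theory Num.Theory.
Import numFieldNormedType.Exports.
Import measurable_realfun.

Local Open Scope classical_set_scope.
Local Open Scope ring_scope.

(* The product of the representing laws [nu i] represents the product of the
   [mu i], but the barycenter identities only see functions of [Cb R (X i)] and
   the spaces need not be completely regular; measurability of a bounded
   continuous [f] on the product for BB, the sigma-algebra generated by boxes of
   cozero sets, and measurability of its integral against the mixtures are thus
   delicate.  Both are avoided by working up to null sets.  On BB,
   Fubini and Dynkin's theorem do give the barycenter identity.  It remains to
   see that [f] agrees with a BB-measurable function on a set of full measure
   belonging to BB: almost every mixture charges that set fully too.
   The slices of [f] through a countable dense set separate points as well as
   [f] does.  Call saturation of a compact set C the union of the fibres of this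
   countable family meeting C; it belongs to BB, and so does that of
   C /\ {f >= c}.  Tightness of the [mu i] (Suslin spaces, intervals) yields
   compact boxes whose saturations exhaust the measure, and these cut
   {f >= c} in sets of BB. *)

(** * Integrals of possibly non-measurable functions, and products *)

Section lower_integral.
Context d (T : measurableType d) (R : realType) (mu : {measure set T -> \bar R}).
Local Open Scope ereal_scope.

Import HBNNSimple.

(** The integral of a nonnegative function is a supremum over the simple functions below it, hence
    monotone without measurability. *)
Lemma le_integral_nomeas (f g : T -> \bar R) : (forall x, f x <= g x) ->
  \int[mu]_x f x <= \int[mu]_x g x.
Proof.
have le0 (u v : T -> \bar R) : (forall x, 0 <= u x) -> (forall x, u x <= v x) ->
    \int[mu]_x u x <= \int[mu]_x v x.
  move=> u0 uv; have v0 x : 0 <= v x by rewrite (le_trans (u0 x)).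
  rewrite !ge0_integralTE//; apply: ereal_sup_le => _ [h hu <-].
  by exists h => // x; rewrite (le_trans (hu x)).
move=> fg; rewrite [leLHS]integralE [leRHS]integralE leeB//; apply: le0 => // x.
  by rewrite !funeposE ge_max !le_max fg lexx orbT.
by rewrite !funenegE ge_max !le_max leeN2 fg lexx orbT.
Qed.

(** For nonnegative functions, a simple function below [f] is below [g] on [B], whose complement is
    null; conversely [g] cut down to [B] lies below [f] everywhere. *)
Lemma ae_eq_integral_nomeas (B : set T) (f g : T -> \bar R) :
  measurable B -> mu (~` B) = 0 -> measurable_fun setT g ->
  (forall x, B x -> f x = g x) -> \int[mu]_x f x = \int[mu]_x g x.
Proof.
move=> mB B0.
have restrE (v : T -> \bar R) : (forall x, 0 <= v x) -> measurable_fun setT v ->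
    \int[mu]_x v x = \int[mu]_(x in B) v x.
  move=> v0 mv; rewrite (@ge0_negligible_integral _ _ _ mu setT (~` B))//.
    by rewrite setTD setCK.
  exact: measurableC.
have ge0 (u v : T -> \bar R) : (forall x, 0 <= u x) -> (forall x, 0 <= v x) ->
    measurable_fun setT v -> (forall x, B x -> u x = v x) ->
    \int[mu]_x u x = \int[mu]_x v x.
  move=> u0 v0 mv uv; apply/eqP; rewrite eq_le; apply/andP; split.
    rewrite [leLHS]ge0_integralTE//; apply: ge_ereal_sup => _ [h hu <-].
    have := integral_nnsfun mu measurableT h; rewrite patch_setT => <-.
    rewrite (restrE v)// (restrE (EFin \o h))//; last 2 first.
    - by move=> x; rewrite /= lee_fin.
    - exact/measurable_EFinP.
 apply: ge0_le_integral => //.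
    - by move=> x _; rewrite lee_fin.
    - exact/measurable_EFinP/measurable_funTS.
    - exact: measurable_funTS.
    - by move=> x Bx; rewrite -uv//; exact: hu.
  rewrite restrE// integral_mkcond; apply: le_integral_nomeas => x.
  by rewrite /patch; case: ifPn => // /[!inE] /uv ->.
move=> mg fg; rewrite [LHS]integralE [RHS]integralE; congr (_ - _); apply: ge0 => //.
- exact: measurable_funepos.
- by move=> x Bx; rewrite !funeposE fg.
- exact: measurable_funeneg.
- by move=> x Bx; rewrite !funenegE fg.
Qed.

End lower_integral.

Section mprod_integral.
Context (I : finType) (d : I -> measure_display)
        (T : forall i, measurableType (d i)) (R : realType).
Local Open Scope ereal_scope.

Lemma measurable_mprod_coord i :
  measurable_fun setT (fun x : mprod T => x i : T i).
Proof.
move=> _ B mB; rewrite setTI.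
by apply: sub_sigma_algebra; exists i, B.
Qed.

Lemma measurable_mprod_prode (h : forall i, T i -> \bar R) :
  (forall i, measurable_fun setT (h i)) ->
  measurable_fun setT (fun x : mprod T => \prod_(i : I) h i (x i)).
Proof.
move=> mh; elim: (index_enum I) => [|i r ih].
    rewrite (_ : (fun x => _) = cst 1)//.
    by apply/funext => x; rewrite big_nil.
  rewrite (_ : (fun x => _) = fun x : mprod T =>
      h i (x i) * \prod_(j <- r) h j (x j)); last first.
    by apply/funext => x; rewrite big_cons.
  apply: emeasurable_funM => //.
  by apply: (measurableT_comp (mh i)); exact: measurable_mprod_coord.
Qed.

(** Tonelli's theorem, once per resampled coordinate. The induction is on the list of resampled
    coordinates; the others still sit at the point of the initial Dirac mass. *)
Lemma ge0_integral_mprod (mu : forall i, probability (T i) R)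
    (g : forall i, T i -> \bar R) :
  (forall i, measurable_fun setT (g i)) -> (forall i x, 0 <= g i x) ->
  \int[mprod_prob mu]_x (\prod_(i : I) g i (x i)) =
  \prod_(i : I) \int[mu i]_x g i x.
Proof.
move=> mg g0.
suff H : forall (s : seq I) (h : forall i, T i -> \bar R), uniq s ->
    (forall i, measurable_fun setT (h i)) -> (forall i x, 0 <= h i x) ->
    \int[foldr (mprod_step mu) (dirac point : probability (mprod T) R) s]_x
      (\prod_(i : I) h i (x i)) =
    (\prod_(i <- s) \int[mu i]_x h i x) *
    \prod_(i | i \notin s) h i ((point : mprod T) i).
  rewrite /mprod_prob H ?enum_uniq// big_enum /= [X in _ * X]big_pred0 ?mule1//.
  by move=> i; rewrite mem_enum.
have P0 (h : forall i, T i -> \bar R) (x : mprod T) :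
    (forall i x, 0 <= h i x) -> 0 <= \prod_(i : I) h i (x i).
  by move=> h0; elim/big_rec: _ => // i y _ y0; rewrite mule_ge0.
elim=> [|i s ih] h /=.
  move=> _ mh h0; rewrite big_nil mul1e integral_dirac//; last first.
    exact: measurable_mprod_prode.
  by rewrite diracT mul1e.
move=> /andP[nis us] mh h0; rewrite big_cons.
rewrite /distribution ge0_integral_pushforward//=; last 2 first.
- exact: measurable_mprod_prode.
- by move=> x _; exact: P0.
(* Resampling [i] comes last and overwrites the earlier value, so factor [i] becomes 1 in the
   remaining integrand. *)
pose h' j := if j == i then cst 1 else h j.
have mh' j : measurable_fun setT (h' j) by rewrite /h'; case: ifP.
have h'0 j x : 0 <= h' j x by rewrite /h'; case: ifP => // _; rewrite lee01.
have hE (x : mprod T) (t : T i) : \prod_j h j (mprod_upd (x, t) j) =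
    h i t * \prod_j h' j (x j).
  rewrite (bigD1 i)//= [in RHS](bigD1 i)//= /h' eqxx mul1e /mprod_upd/= dfwithin.
  congr (_ * _); apply: eq_bigr => j ji.
  by rewrite (negbTE ji) dfwithout// eq_sym.
rewrite preimage_setT (eq_integral (fun x : mprod T * T i =>
    h i x.2 * \prod_j h' j (x.1 j))); last by move=> [x t] _; exact: hE.
rewrite fubini_tonelli1//=; last 2 first.
- apply: emeasurable_funM.
    exact: (measurableT_comp (mh i)).
  by apply: (measurableT_comp (measurable_mprod_prode mh')).
- by move=> x; rewrite mule_ge0// P0.
rewrite (eq_integral (fun x : mprod T =>
    (\int[mu i]_t h i t) * \prod_j h' j (x j))); last first.
  move=> x _; rewrite /fubini_F /= ge0_integralZr//; exact: P0.
rewrite ge0_integralZl//; last 3 first.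
- exact: measurable_mprod_prode.
- by move=> x _; exact: P0.
- by apply: integral_ge0.
rewrite ih// -muleA; congr (_ * _); congr (_ * _).
  rewrite big_seq [RHS]big_seq; apply: eq_bigr => j js.
  by rewrite /h'; case: eqVneq => // ji; rewrite -ji js in nis.
rewrite (bigD1 i)//= {1}/h' eqxx mul1e; apply: eq_big => [j|j].
  by rewrite inE negb_or andbC.
by move=> /andP[_ ji]; rewrite /h' (negbTE ji).
Qed.

End mprod_integral.

(** * Cozero sets and barycenters *)

Lemma continuous_measurable_borel (R : realType) (T : ptopologicalType)
  (u : T -> R) : continuous u -> measurable_fun [set: borel T] u.
Proof.
move=> /continuousP cu; apply: (measurability _ (RGenOpens.measurableE R)).
move=> _ [_ [a [b ->] <-]]; rewrite setTI; apply: sub_sigma_algebra.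
exact/cu/interval_open.
Qed.

Lemma Cb_min (R : realType) (U : topologicalType) (u v : U -> R) :
  Cb R U u -> Cb R U v -> Cb R U (fun x => Num.min (u x) (v x)).
Proof.
move=> [cu [M [Mr bu]]] [cv [N [Nr bv]]]; split.
  move=> x.
  suff H : {for x, continuous ((u : U -> R^o) \min v)} by exact: H.
  by apply: continuous_min; [exact: cu|exact: cv].
exists (Num.max M N); split; first exact: num_real.
move=> P; rewrite gt_max => /andP[MP NP] x _ /=.
by rewrite minEle; case: ifP => _; [exact: bu|exact: bv].
Qed.

Section cozero.
Context (R : realType) (T : ptopologicalType).

(** Increases to the indicator of the cozero set of points where [0 < u x]; monotone convergence
    then transfers identities from [Cb R T] to cozero sets. *)
Let approx (u : T -> R) n : T -> R := fun x => Num.min 1 (n%:R * Num.max (u x) 0).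

Let Cb_approx u n : Cb R T u -> Cb R T (approx u n).
Proof.
move=> [cu bu]; split.
  move=> x.
  suff H : {for x, continuous ((cst 1 : T -> R^o) \min
                               ((cst n%:R : T -> R^o) \* (u \max cst 0)))} by exact: H.
  apply: continuous_min; first exact: cvg_cst.
  apply: continuousM; first exact: cvg_cst.
  by apply: continuous_max; [exact: cu|exact: cvg_cst].
exists 1; split => // M M1 x _; apply: (le_trans _ (ltW M1)).
have n0 : 0 <= n%:R * Num.max (u x) 0 by rewrite mulr_ge0// le_max lexx orbT.
by rewrite /approx ger0_norm ?ge_min ?lexx// le_min ler01.
Qed.

Let approx_ge0 u n x : 0 <= approx u n x.
Proof. by rewrite /approx le_min ler01 mulr_ge0// le_max lexx orbT. Qed.

Let nd_approx u x : {homo (approx u)^~ x : m n / (m <= n)%N >-> m <= n}.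
Proof.
move=> m n mn; rewrite /approx le_min ge_min lexx/= ge_min.
by rewrite ler_wpM2r ?orbT ?ler_nat// le_max lexx orbT.
Qed.

Let cvg_approx u x : (approx u n x)%:E @[n --> \oo] -->
  (\1_([set y | 0 < u y]) x : R)%:E.
Proof.
apply: cvg_EFin; first by near=> n.
rewrite indicE; have [ux|ux] := ltP 0 (u x).
  rewrite mem_set//; apply: cvg_near_cst; near=> n.
  rewrite /approx/= max_l ?ltW//; apply/min_l.
  rewrite -ler_pdivrMr// mul1r; near: n; exact: nbhs_infty_ger.
rewrite memNset/=; last by apply/negP; rewrite -leNgt.
apply: cvg_near_cst; near=> n.
by rewrite /approx max_r//= mulr0 min_r.
Unshelve. all: by end_near. Qed.

Lemma measurable_cozero_set (u : T -> R) : Cb R T u ->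
  measurable ([set x | 0 < u x] : set (borel T)).
Proof.
move=> -[cu _]; apply: sub_sigma_algebra.
rewrite -[X in open X]/(u @^-1` [set r | 0 < r]).
by apply: open_comp; [move=> x _; exact: cu|exact: open_gt].
Qed.

Lemma cvg_integral_cozero (u : T -> R) (m : probability (borel T) R) :
  Cb R T u -> (\int[m]_x (approx u n x)%:E)%E @[n --> \oo] --> m [set x | (0 < u x)%R].
Proof.
move=> Cu; have mA := measurable_cozero_set Cu.
rewrite -(setIT [set x | (0 < u x)%R]) -integral_indic//.
rewrite (eq_integral (fun x : borel T => limn (fun n => (approx u n x)%:E)));
  last first.
  by move=> x _; rewrite (cvg_lim _ (@cvg_approx u x)).
apply: cvg_monotone_convergence => //.
- move=> n; apply/measurable_EFinP; apply: continuous_measurable_borel.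
  by have [] := Cb_approx n Cu.
- by move=> n x _; rewrite lee_fin.
- by move=> x _ m1 n mn; rewrite lee_fin nd_approx.
Qed.

Context d (S : measurableType d) (kappa : S -> probability (borel T) R)
  (mu : probability (borel T) R) (nu : probability S R).
Hypothesis mkappa : forall u, Cb R T u ->
  measurable_fun setT (fun s => \int[kappa s]_x (u x)%:E)%E.

Lemma measurable_cozero u : Cb R T u ->
  measurable_fun setT (fun s => kappa s [set x | (0 < u x)%R]).
Proof.
move=> Cu; apply: (@emeasurable_fun_cvg _ _ _ _
  (fun n s => \int[kappa s]_x (approx u n x)%:E)%E) => [n|s _].
  exact/mkappa/Cb_approx.
exact: cvg_integral_cozero.
Qed.

Lemma barycenter_cozero u : barycenter mu nu kappa (Cb R T) -> Cb R T u ->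
  (\int[nu]_s kappa s [set x | (0 < u x)%R] = mu [set x | (0 < u x)%R])%E.
Proof.
move=> bar Cu.
rewrite (eq_integral (fun s => limn (fun n => \int[kappa s]_x (approx u n x)%:E)%E));
  last first.
  by move=> s _; rewrite (cvg_lim _ (@cvg_integral_cozero u (kappa s) Cu)).
rewrite monotone_convergence//.
- under eq_fun do rewrite -(bar _ (Cb_approx _ Cu)).
  by rewrite (cvg_lim _ (@cvg_integral_cozero u mu Cu)).
- by move=> n; exact/mkappa/Cb_approx.
- by move=> n s _; apply: integral_ge0 => x _; rewrite lee_fin.
- move=> s _ m n mn; apply: le_integral_nomeas => x.
  by rewrite lee_fin nd_approx.
Qed.

End cozero.

(** * Product representations on the sigma-algebra of cozero boxes *)

Section product_barycenter.
Context (R : realType) (I : finType) (T : I -> ptopologicalType)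
  (d : I -> measure_display) (S : forall i, measurableType (d i))
  (kappa : forall i, S i -> probability (borel (T i)) R)
  (mu : forall i, probability (borel (T i)) R) (nu : forall i, probability (S i) R).
Arguments kappa {i}.

Hypothesis mkappa : forall i u, Cb R (T i) u ->
  measurable_fun setT (fun s : S i => \int[kappa s]_x (u x)%:E)%E.
Hypothesis bary : forall i, barycenter (mu i) (nu i) kappa (Cb R (T i)).

(** Cozero sets replace open sets because their indicators are monotone limits of functions in
    [Cb]. *)
Definition cozero_boxes : set (set (forall i, T i)) :=
  [set B | exists2 u : forall i, T i -> R, (forall i, Cb R (T i) (u i)) &
    B = [set x | forall i, 0 < u i (x i)]].

Let X := mprod (fun i => borel (T i)).
Let Y := g_sigma_algebraType cozero_boxes.
Let K (s : mprod S) : probability X R := mprod_prob (fun i => kappa (s i)).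

Lemma sub_cozero_boxes : <<s cozero_boxes>> `<=` (measurable : set (set X)).
Proof.
apply: smallest_sub; first exact: sigma_algebra_measurable.
move=> _ [u Cu ->]; apply: (@measurable_box I _ (fun i => borel (T i))
  (fun i => [set x | 0 < u i x])) => i.
exact: measurable_cozero_set.
Qed.

Lemma setI_closed_cozero_boxes : setI_closed cozero_boxes.
Proof.
move=> _ _ [u Cu ->] [v Cv ->].
exists (fun i x => Num.min (u i x) (v i x)).
  by move=> i; exact: Cb_min.
apply/seteqP; split => x /=.
  by move=> [ux vx] i; rewrite lt_min ux vx.
by move=> uv; split => i; have := uv i; rewrite lt_min => /andP[].
Qed.

Lemma barycenter_cozero_boxes (A : set (forall i, T i)) : <<s cozero_boxes>> A ->
  measurable_fun setT (fun s => K s A) /\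
  (\int[mprod_prob nu]_s K s A = mprod_prob mu A)%E.
Proof.
move: A; apply: (@dynkin_induction _ Y cozero_boxes) => //.
- exact: setI_closed_cozero_boxes.
- split.
    by apply: (eq_measurable_fun (cst 1%E)) => // s _; rewrite probability_setT.
  under eq_integral do rewrite probability_setT.
  rewrite integral_cst// mul1e.
  by transitivity (1%E : \bar R); [|apply/esym]; exact: probability_setT.
- move=> _ [u Cu ->].
  pose g i (s : S i) := kappa s [set x | 0 < u i x]%R.
  have mg i : measurable_fun setT (g i).
    by apply: measurable_cozero => // v; exact: mkappa.
  have KE s : K s [set x | forall i, 0 < u i (x i)] = (\prod_i g i (s i))%E.
    rewrite /K (@mprod_probE I _ (fun i => borel (T i)) R _
      (fun i => [set x | 0 < u i x]))// => i.
    exact: measurable_cozero_set.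
  split.
    apply: (eq_measurable_fun (fun s : mprod S => \prod_i g i (s i))%E) => //.
    exact: measurable_mprod_prode.
  under eq_integral do rewrite KE.
  rewrite ge0_integral_mprod// (@mprod_probE I _ (fun i => borel (T i)) R _
    (fun i => [set x | 0 < u i x])).
    apply: eq_bigr => i _; apply: barycenter_cozero => // v; exact: mkappa.
  by move=> i; exact: measurable_cozero_set.
- move=> A mA [mKA KA]; have mXA := sub_cozero_boxes mA.
  have mXC := measurableC mXA; split.
    apply: (eq_measurable_fun (fun s => 1 - K s A)%E) => [s _|].
      by rewrite probability_setC.
    by apply: emeasurable_funB => //; exact: measurable_cst.
  under eq_integral do rewrite probability_setC//.
  rewrite integralB//; last 2 first.
  - exact: finite_measure_integrable_cst.
  - apply: (@le_integrable _ _ _ _ _ _ _ (cst 1%E)) => //.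
      by move=> s _; rewrite gee0_abs//= normr1 probability_le1.
    exact: finite_measure_integrable_cst.
  rewrite integral_cst// mul1e KA (probability_setC (mprod_prob mu))//.
  by congr (_ - _)%E; exact: probability_setT.
- move=> F mF tF KF.
  have mXF n := sub_cozero_boxes (mF n).
  have KE s : K s (\bigcup_k F k) = (\sum_(k <oo) K s (F k))%E.
    by rewrite measure_semi_bigcup//; exact: bigcupT_measurable.
  split.
    apply: (eq_measurable_fun (fun s => \sum_(k <oo) K s (F k))%E) => //.
    by apply: ge0_emeasurable_sum => // k _; exact: (KF k).1.
  under eq_integral do rewrite KE.
  rewrite integral_nneseries//; last by move=> k; exact: (KF k).1.
  rewrite measure_semi_bigcup//; last exact: bigcupT_measurable.
  by apply: eq_eseriesr => k _; exact: (KF k).2.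
Qed.

Let measurable_idXY : measurable_fun [set: X] (idfun : X -> Y).
Proof.
by move=> _ B mB; rewrite setTI; exact: sub_cozero_boxes.
Qed.

(** [K s] on the coarser sigma-algebra of [Y], as a point of the Giry space, whose operations
    provide measurability and disintegration of integrals. *)
Let KY (s : mprod S) : giry Y R := giry_map measurable_idXY (K s).

Let measurable_KY : measurable_fun setT KY.
Proof.
apply: measurable_giry_codensity => // B mB.
exact: (barycenter_cozero_boxes mB).1.
Qed.

Let integral_KY (g : Y -> \bar R) s : measurable_fun [set: Y] g ->
  (forall x, 0 <= g x)%E -> (\int[K s]_x g x = giry_int (KY s) g)%E.
Proof. by move=> mg g0; rewrite giry_int_map. Qed.

Lemma measurable_ge0_integral_cozero (g : Y -> \bar R) :
  measurable_fun [set: Y] g -> (forall x, 0 <= g x)%E ->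
  measurable_fun setT (fun s => \int[K s]_x g x)%E.
Proof.
move=> mg g0; apply: (eq_measurable_fun (fun s => giry_int (KY s) g)).
  by move=> s _; rewrite -integral_KY.
exact: (measurableT_comp (measurable_giry_int mg g0) measurable_KY).
Qed.

(** Both sides integrate [g] against measures on [Y]: the mixture of the [KY s] and the image of the
    product of the [mu i]. These agree by [barycenter_cozero_boxes]. *)
Lemma barycenter_ge0_cozero (g : Y -> \bar R) :
  measurable_fun [set: Y] g -> (forall x, 0 <= g x)%E ->
  (\int[mprod_prob nu]_s \int[K s]_x g x = \int[mprod_prob mu]_x g x)%E.
Proof.
move=> mg g0.
transitivity (giry_int (giry_map measurable_idXY (mprod_prob mu)) g); last first.
  by rewrite giry_int_map.
transitivity (giry_int (giry_bind (mprod_prob nu) measurable_KY) g).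
  rewrite giry_int_bind//; apply: eq_integral => s _.
  exact: integral_KY.
apply: eq_measure_integral => A mA _.
rewrite /giry_bind /= giry_int_map//; last exact: measurable_giry_ev.
exact: (barycenter_cozero_boxes mA).2.
Qed.

Lemma measurable_integral_cozero (g : Y -> R) : measurable_fun [set: Y] g ->
  measurable_fun setT (fun s => \int[K s]_x (g x)%:E)%E.
Proof.
move=> /measurable_EFinP mg.
apply: (eq_measurable_fun (fun s =>
  \int[K s]_x ((EFin \o g)^\+ x) - \int[K s]_x ((EFin \o g)^\- x))%E).
  by move=> s _; rewrite -integralE.
apply: emeasurable_funB; apply: measurable_ge0_integral_cozero => //.
  exact: measurable_funepos.
exact: measurable_funeneg.
Qed.

Lemma barycenter_bounded_cozero (g : Y -> R) :
  measurable_fun [set: Y] g -> bounded_fun g ->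
  (\int[mprod_prob nu]_s \int[K s]_x (g x)%:E = \int[mprod_prob mu]_x (g x)%:E)%E.
Proof.
move=> /measurable_EFinP mg [M [Mr bg]].
have mgp := measurable_funepos mg; have mgn := measurable_funeneg mg.
(* Boundedness speaks of every number above [M], hence the added 1. The bound keeps the integrals of
   both parts finite, so that they can be subtracted. *)
have gle x : (`|(g x)%:E| <= (`|M| + 1)%:E)%E.
  by rewrite lee_fin bg// (le_lt_trans (ler_norm M))// ltrDl.
have gple x : (0 <= (EFin \o g)^\+ x <= (`|M| + 1)%:E)%E.
  rewrite funepos_ge0 (le_trans _ (gle x))//.
  by rewrite -[leRHS]/((abse \o (EFin \o g)) x) fune_abse leeDl.
have gnle x : (0 <= (EFin \o g)^\- x <= (`|M| + 1)%:E)%E.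
  rewrite funeneg_ge0 (le_trans _ (gle x))//.
  by rewrite -[leRHS]/((abse \o (EFin \o g)) x) fune_abse leeDr.
have bnd (h : Y -> \bar R) s : (forall x, 0 <= h x <= (`|M| + 1)%:E)%E ->
    (0 <= \int[K s]_x h x <= (`|M| + 1)%:E)%E.
  move=> hb; rewrite integral_ge0/=; last by move=> x _; have /andP[] := hb x.
  apply: (@le_trans _ _ (\int[K s]_x (`|M| + 1)%:E)%E).
    by apply: le_integral_nomeas => x; have /andP[] := hb x.
  by rewrite integral_cst// [X in (_ * X)%E](@probability_setT _ X) mule1.
have int (h : Y -> \bar R) : measurable_fun setT h ->
    (forall x, 0 <= h x <= (`|M| + 1)%:E)%E ->
    (mprod_prob nu).-integrable setT (fun s => \int[K s]_x h x)%E.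
  move=> mh hb; apply: (@le_integrable _ _ _ _ _ _ _ (cst (`|M| + 1)%:E)) => //.
  - by apply: measurable_ge0_integral_cozero => // x; have /andP[] := hb x.
  - move=> s _; have /andP[h0 h1] := bnd _ s hb.
    by rewrite gee0_abs// (le_trans h1)//= lee_fin ler_norm.
  - exact: finite_measure_integrable_cst.
rewrite [RHS]integralE.
under [LHS]eq_integral do rewrite integralE.
rewrite integralB//; [|exact: int|exact: int].
by congr (_ - _)%E; apply: barycenter_ge0_cozero.
Qed.

End product_barycenter.

(** * Saturated compact sets *)

Section saturation.
Context (R : realType) (T : topologicalType) (e : nat -> T -> R).
Hypothesis ce : forall n, continuous (e n).

Definition saturation (C : set T) : set T :=
  [set x | exists2 c, C c & forall n, e n x = e n c].

(** One index rules the number of functions tested and the precision: each box is open, and the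
    boxes around [c] shrink as [n] grows. *)
Let box n (c : T) : set T :=
  [set x | forall m, (m <= n)%N -> `|e m x - e m c| < n.+1%:R^-1].

Let open_box n c : open (box n c).
Proof.
rewrite openE => x xc; rewrite /interior.
have : \forall y \near x, forall m : 'I_n.+1, `|e m y - e m c| < n.+1%:R^-1.
  apply: filter_forall => m.
  have : (fun y => `|e m y - e m c|) @ x --> `|e m x - e m c|.
    by apply: cvg_norm; apply: cvgB; [exact: ce|exact: cvg_cst].
  by move/cvgr_lt; apply; apply: xc; rewrite -ltnS.
apply: filterS => y yc m mn.
by have := yc (Ordinal (mn : (m < n.+1)%N)).
Qed.

Definition saturation_nbhd (C : set T) n : set T := \bigcup_(c in C) box n c.

Lemma open_saturation_nbhd C n : open (saturation_nbhd C n).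
Proof. by apply: bigcup_open => c _; exact: open_box. Qed.

Lemma sub_saturation C : C `<=` saturation C.
Proof. by move=> x Cx; exists x. Qed.

Lemma sub_saturation_nbhd C n : saturation C `<=` saturation_nbhd C n.
Proof.
by move=> x [c Cc xc]; exists c => // m _; rewrite xc subrr normr0.
Qed.

Lemma nonincreasing_saturation_nbhd C : nonincreasing_seq (saturation_nbhd C).
Proof.
move=> m n mn; apply/subsetPset => x [c Cc xc]; exists c => // k km.
by rewrite (lt_le_trans (xc k (leq_trans km mn)))// lef_pV2 ?posrE// ler_nat.
Qed.

(** Choose [c n] in [C] whose box of index [n] contains [x]. At a cluster point of this sequence in
    [C], every [e m] takes the same value as at [x]. *)
Lemma bigcap_saturation_nbhd C : compact C ->
  \bigcap_n saturation_nbhd C n = saturation C.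
Proof.
move=> cC; apply/seteqP; split => x; last first.
  by move=> Cx n _; exact: sub_saturation_nbhd.
move=> xC; have /choice[c cP] n : exists c, C c /\ box n c x.
  by have [c Cc xc] := xC n I; exists c.
have [|y [Cy yc]] := cC (c @ \oo).
  by exists 0%N => // n _; have [] := cP n.
exists y => // m; apply/eqP; rewrite -subr_eq0 -normr_le0; apply/ler_addgt0Pl => r r0.
rewrite addr0.
have : (c @ \oo) (c @` [set n | (m <= n)%N /\ n.+1%:R^-1 < r / 2]).
  have r20 : 0 < r / 2 by rewrite divr_gt0.
  have := near_infty_natSinv_lt (PosNum r20).
  apply: filterS2 (nbhs_infty_ge m) => n mn nr.
  by exists n.
have : nbhs y [set z | `|e m y - e m z| < r / 2].
  have : (fun z => `|e m y - e m z|) @ y --> `|e m y - e m y|.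
    by apply: cvg_norm; apply: cvgB; [exact: cvg_cst|exact: ce].
  by rewrite subrr normr0 => /cvgr_lt; apply; rewrite divr_gt0.
move=> ny /yc/(_ ny)[_ [[n [mn nr] <-]]] /= yn.
have xn : `|e m x - e m (c n)| < r / 2.
  by have [_ /(_ m mn) /lt_trans] := cP n; exact.
rewrite (_ : e m x - e m y = (e m x - e m (c n)) - (e m y - e m (c n))); last by ring.
by rewrite (le_trans (ler_normB _ _))// (splitr r) lerD// ltW.
Qed.

(** By compactness finitely many boxes of each index cover [C], and the intersection of these finite
    unions is the saturation. It thus involves the [e n] only, and is measurable for any
    sigma-algebra that makes them so. *)
Lemma measurable_saturation d (Y : measurableType d) (h : Y -> T) (C : set T) :
  (forall n, measurable_fun setT (e n \o h)) -> compact C ->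
  measurable (h @^-1` saturation C).
Proof.
move=> me cC.
have /choice[F FP] n : exists F : {fset T}, {subset F <= C} /\
    C `<=` \bigcup_(c in [set` F]) box n c.
  have [->|/set0P[c0 _]] := eqVneq C set0.
    by exists fset0%fset; split=> // c; rewrite inE.
  move: (cC : compact (C : set (based c0))).
  rewrite compact_cover => /(_ T C (box n)) [].
  - by move=> c _; exact: open_box.
  - by move=> c Cc; exists c => // m _; rewrite subrr normr0.
  - by move=> F FC CF; exists F.
rewrite (_ : saturation C = \bigcap_n \bigcup_(c in [set` F n]) box n c).
  rewrite preimage_bigcap; apply: bigcapT_measurable => n.
  rewrite preimage_bigcup; apply: fin_bigcup_measurable => // c _.
  rewrite (_ : _ @^-1` _ = \bigcap_(m in `I_n.+1)
      ((fun y => `|e m (h y) - e m c|) @^-1` `]-oo, n.+1%:R^-1[)).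
    apply: fin_bigcap_measurable => // m _; rewrite -[X in measurable X]setTI.
    have mf : measurable_fun setT (fun y => `|e m (h y) - e m c|).
      apply: (@measurableT_comp _ _ _ _ _ _ (@Num.norm R R)) => //.
      exact: (@measurable_funB _ _ R setT (e m \o h)).
    exact: mf.
  apply/seteqP; split => y /= yc m; have := yc m; rewrite /= in_itv/= ltnS; exact.
apply/seteqP; split => x; last first.
  move=> xF; rewrite -bigcap_saturation_nbhd// => n _.
  have [c cF xc] := xF n I; exists c => //.
  by have [FC _] := FP n; exact/set_mem/FC.
(* Boxes are unions of fibres: the box that covers [c] also contains [x]. *)
move=> [c Cc xc] n _; have [_ /(_ _ Cc)[c' c'F cc']] := FP n.
by exists c' => // m mn; rewrite xc; exact: cc'.
Qed.

End saturation.

(** * Tightness *)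

(** The bound is on open neighbourhoods of [K]: without a separation axiom, a compact set need not
    be Borel. *)
Definition tight (R : realType) (T : ptopologicalType) : Prop :=
  forall (mu : probability (borel T) R) (eps : R), 0 < eps ->
  exists K : set T, compact K /\
    forall U, open U -> K `<=` U -> ((1 - eps)%:E <= mu U)%E.

Lemma countable_dense_seq (T : ptopologicalType) (D : set T) :
  countable D -> dense D -> exists p : nat -> T, dense (range p).
Proof.
move=> /pfcard_geP[->|[p]] dD; exists (p : nat -> T) || exists (fun=> point).
  have [x [_ []]] : [set: T] `&` set0 !=set0.
    by apply: dD; [exists point|exact: openT].
move=> U U0 oU; have [x [Ux Dx]] := dD U U0 oU; exists x; split => //.
by have [n _ <-] := 'surj_p Dx; exists n.
Qed.

Section outer_lower_bound.
Context d (T : measurableType d) (R : realType) (mu : probability T R).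

(** A lower bound on the outer measure of a possibly non-measurable set. *)
Definition outer_ge (c : R) (A : set T) : Prop :=
  forall B, measurable B -> A `<=` B -> (c%:E <= mu B)%E.

(** Continuity from below of the outer measure. Were each [A n] inside a measurable [B n] of mass
    below [c'], the tail intersections of the [B n] would increase, contain the [A n], and have a
    union of mass at most [c']. *)
Lemma outer_ge_bigcup (A : nat -> set T) (c c' : R) : c' < c ->
  nondecreasing_seq A -> outer_ge c (\bigcup_n A n) -> exists n, outer_ge c' (A n).
Proof.
move=> c'c ndA cA; apply: contrapT => /forallNP noA.
have /choice[B BP] n : exists B, [/\ measurable B, A n `<=` B & (mu B < c'%:E)%E].
  have /existsNP[B /not_implyP[mB /not_implyP[AB /negP]]] := noA n.
  by rewrite -ltNge => Bc; exists B.
pose H n := \bigcap_(k in [set k | (n <= k)%N]) B k.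
have mH n : measurable (H n).
  by apply: bigcap_measurable => [|k _]; [exists n => /=|have [] := BP k].
have ndH : nondecreasing_seq H.
  move=> m n mn; apply/subsetPset => x Hx k /= nk.
  by apply: Hx; exact: leq_trans nk.
have AH : \bigcup_n A n `<=` \bigcup_n H n.
  apply: subset_bigcup => n _ x Ax k /= nk; have [_ AB _] := BP k; apply: AB.
  by have /subsetPset := ndA _ _ nk; apply.
have := cA _ (bigcupT_measurable _ mH) AH; apply/negP; rewrite -ltNge.
apply: (@le_lt_trans _ _ c'%:E); last by rewrite lte_fin.
apply: (cvge_le _ (nondecreasing_cvg_mu mH (bigcupT_measurable _ mH) ndH)).
apply: nearW => n /=; have [mB _ /ltW Bc] := BP n; apply: (le_trans _ Bc).
by apply: le_measure; rewrite ?mem_set// => x; apply => /=.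
Qed.

End outer_lower_bound.

(** * Tightness of Suslin spaces *)

Section suslin_tight.
Context (R : realType) (T : ptopologicalType) (P : completePseudoMetricType R)
  (f : P -> T) (p : nat -> P).
Hypotheses (cf : continuous f) (f_surj : range f = setT) (dp : dense (range p)).

Let rad j : R := j.+1%:R^-1.
Let rad_gt0 j : 0 < rad j. Proof. by rewrite invr_gt0. Qed.

(** The radius is halved so that these closed balls lie in the open balls of radius [rad j]. *)
Let V j k : set P := \bigcup_(i in `I_k) closed_ball (p i) (rad j / 2).

Let closedV j k : closed (V j k).
Proof. by apply: closed_bigcup => // i _; exact: closed_ball_closed. Qed.

Let ndV j : nondecreasing_seq (V j).
Proof.
move=> m n mn; apply/subsetPset => x [i im xi]; exists i => //.
exact: leq_trans mn.
Qed.

Let coverV j : \bigcup_k V j k = setT.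
Proof.
apply/seteqP; split => // x _.
have r0 : 0 < rad j / 2 by rewrite divr_gt0.
have [||y [xy [i _ iy]]] := dp (O := (ball x (rad j / 2))^°).
- by exists x; exact: nbhsx_ballx.
- exact: open_interior.
exists i.+1 => //; exists i => //=; apply: subset_closed_ball.
rewrite iy; apply: ball_sym; exact: interior_subset.
Qed.

Section scheme.
Variable k : nat -> set P -> nat.

(** Finitely many balls cover each stage, so the intersection of all stages is closed and totally
    bounded. [k] takes the current stage as argument since the number of balls to keep depends on
    it. *)
Fixpoint scheme n : set P :=
  if n is m.+1 then scheme m `&` V m (k m (scheme m)) else setT.

Let closed_scheme n : closed (scheme n).
Proof. by elim: n => [|n ih] /=; [exact: closedT|exact: closedI]. Qed.

Let scheme_dec m n : (m <= n)%N -> scheme n `<=` scheme m.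
Proof.
move=> /subnK <-; elim: (n - m)%N => [//|l ih] x /= [sx _].
exact: ih.
Qed.

(** Total boundedness puts a ball of every radius in [F], which is thus Cauchy and converges by
    completeness; the stages are closed, so they contain the limit. *)
Let ultra_scheme (F : set_system P) : UltraFilter F -> (forall n, F (scheme n)) ->
  exists x, (forall n, scheme n x) /\ F --> x.
Proof.
move=> FU Fs; have cvF : cvg F.
  apply/cauchy_cvgP/cauchyP => e e0.
  have [n ne] : exists n, rad n < e.
    have [n _ /(_ n (leqnn n))] := near_infty_natSinv_lt (PosNum e0); by exists n.
  apply: contrapT => /forallNP noball.
  have [_ FV] : F (scheme n) /\ F (V n (k n (scheme n))).
    by split => //; apply: filterS (Fs n.+1) => x [].
  (* If no ball belongs to [F], the complements of finitely many do, and some point of the cover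
     avoids all its balls. *)
  have : \forall x \near F, forall i : 'I_(k n (scheme n)), ~ ball (p i) e x.
    apply: filter_forall => i.
    by have [/noball|] := in_ultra_setVsetC (ball (p i) e) FU.
  move=> /(filterI FV)/filter_ex[x [[i ik xi] /(_ (Ordinal ik))]]; apply.
  by apply: (le_ball (ltW ne)); exact: subset_closure_half xi.
exists (lim F); split => // n.
exact: (closed_cvg (u_ := id) _ (@closed_scheme n) (Fs n) _ cvF).
Qed.

Lemma compact_scheme : compact (\bigcap_n scheme n).
Proof.
rewrite compact_ultra => F FU FK.
have [n|x [xs Fx]] := ultra_scheme FU.
  by apply: filterS FK => x; exact.
by exists x; split => // n _; exact: xs.
Qed.

(** Points of the stages outside [W] would converge, along an ultrafilter, to a point of the
    intersection, hence of the open set [W]. *)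
Lemma scheme_open W : open W -> \bigcap_n scheme n `<=` W ->
  exists n, scheme n `<=` W.
Proof.
move=> oW KW; apply: contrapT => /forallNP noW.
have /choice[x xP] n : exists x, scheme n x /\ ~ W x.
  by have /existsNP[x /not_implyP[sx Wx]] := noW n; exists x.
have [G [GU xG]] := ultraFilterLemma (fmap_proper_filter x _ : ProperFilter (x @ \oo)).
have [n|y [ys Gy]] := ultra_scheme GU.
  apply: xG; exists n => // m nm; apply: (scheme_dec nm).
  by have [] := xP m.
have GW : G W by apply: Gy; apply: open_nbhs_nbhs; split => //; apply: KW.
have GnW : G (~` W) by apply: xG; exists 0%N => // n _; have [] := xP n.
by have [z []] := filter_ex (filterI GW GnW).
Qed.

End scheme.

(* Ulam's argument, run on the outer measure since the images [f @` A] need not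
   be Borel. *)
Lemma suslin_image_tight : tight R T.
Proof.
(* [c] starts at 1, the total mass, and strictly decreases to [1 - eps]: each cut by some [V n m]
   may lose a little. *)
move=> mu eps eps0; pose c n : R := 1 - eps + eps / n.+1%:R.
have cdec n : c n.+1 < c n by rewrite ltrD2l ltr_pM2l// ltf_pV2 ?posrE// ltr_nat.
have /choice[k kP] : forall n, exists k : set P -> nat, forall A,
    outer_ge mu (c n) (f @` A) -> outer_ge mu (c n.+1) (f @` (A `&` V n (k A))).
  move=> n; suff /choice[g gP] A : exists m, outer_ge mu (c n) (f @` A) ->
      outer_ge mu (c n.+1) (f @` (A `&` V n m)) by exists g.
  have [cA|ncA] := pselect (outer_ge mu (c n) (f @` A)); last by exists 0%N.
  have [||m mP] := @outer_ge_bigcup _ _ _ mu (fun m => f @` (A `&` V n m)) _ _ (cdec n).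
  - move=> i j ij; apply/subsetPset => _ [x [Ax Vx] <-]; exists x => //; split => //.
    by have /subsetPset := ndV n ij; apply.
  - by rewrite -image_bigcup -setI_bigcupr coverV setIT.
  - by exists m.
have big n : outer_ge mu (c n) (f @` scheme k n).
  elim: n => [|n ih]; last exact: kP.
  move=> B mB; rewrite /= f_surj subTset => ->.
  by rewrite probability_setT lee_fin /c invr1 mulr1 subrK.
exists (f @` \bigcap_n scheme k n); split.
  apply: continuous_compact; last exact: compact_scheme.
  exact: continuous_subspaceT.
move=> U oU KU; have [||n nU] := @scheme_open k (f @^-1` U).
- by apply: open_comp => // x _; exact: cf.
- by move=> x Kx; apply: KU; exists x.
apply: (@le_trans _ _ (c n)%:E); first by rewrite lee_fin lerDl divr_ge0// ltW.
apply: big; first exact: sub_sigma_algebra.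
by move=> _ [x sx <-]; exact: nU.
Qed.

End suslin_tight.

Lemma suslin_tight (R : realType) (T : ptopologicalType) : suslin R T -> tight R T.
Proof.
move=> [P [f [_ [D cD dD] cf fT]]].
have [p dp] := countable_dense_seq cD dD.
exact: suslin_image_tight cf fT dp.
Qed.

Lemma suslin_dense_seq (R : realType) (T : ptopologicalType) :
  suslin R T -> exists p : nat -> T, dense (range p).
Proof.
move=> [P [f [_ [D cD dD] cf fT]]].
have [p dp] := countable_dense_seq cD dD.
exists (f \o p) => U [x Ux] oU.
have [||y [Uy [n _ ny]]] := dp (f @^-1` U).
- have : range f x by rewrite fT.
  by move=> [y _ yx]; exists y; rewrite /= yx.
- by apply: open_comp => // y _; exact: cf.
by exists (f y); split => //; exists n => //=; rewrite ny.
Qed.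

(** * Tightness of intervals *)

Section sigma_compact_line.
Context (R : realType) (T : ptopologicalType) (h : nat -> R -> T)
  (l u : nat -> R).
Hypotheses (ch : forall n, continuous (h n))
  (hT : \bigcup_n h n @` `[l n, u n] = setT).

Lemma segment_images_tight : tight R T.
Proof.
move=> mu eps eps0.
pose K n := \bigcup_(m in `I_n) (h m @` `[l m, u m]).
have [|||n Kn] := @outer_ge_bigcup _ _ _ mu K 1 (1 - eps).
- by rewrite gtrBl.
- move=> m n mn; apply/subsetPset => x [k km kx]; exists k => //.
  exact: leq_trans mn.
- move=> B mB KB; rewrite (_ : B = setT) ?probability_setT//.
  rewrite -subTset -hT => x [n _ nx]; apply: KB.
  by exists n.+1 => //; exists n => /=.
exists (K n); split => [|U oU KU]; last first.
  by apply: Kn => //; exact: sub_sigma_algebra.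
rewrite /K bigcup_mkord; apply: bigsetU_compact => m _; apply: continuous_compact.
  exact/continuous_subspaceT/ch.
exact: segment_compact.
Qed.

Lemma segment_images_dense_seq : exists p : nat -> T, dense (range p).
Proof.
pose D := range (fun nq : nat * rat => h nq.1 (ratr nq.2)).
apply: (@countable_dense_seq T D).
  exact: sub_countable (card_image_le _ _) (countableP _).
move=> U [x Ux] oU.
have [n _ [t _ tx]] : (\bigcup_n h n @` `[l n, u n]) x by rewrite hT.
have [||y [Uy [q _ qy]]] := @dense_rat R (h n @^-1` U).
- by exists t; rewrite /= tx.
- by apply: open_comp => // y _; exact: ch.
by exists (h n y); split => //; exists (n, q) => //=; rewrite qy.
Qed.

End sigma_compact_line.

Section interval.
Context (R : realType) (J : interval R) (a : [set` J]).

Lemma interval_valP (x y : [set` J]) (t : R) :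
  set_val x <= t <= set_val y -> exists z : [set` J], set_val z = t.
Proof.
move=> xty; have Jt : t \in [set` J].
  by apply/mem_set; apply: interval_is_interval xty; apply/set_mem; exact: valP.
by exists (SigSub Jt).
Qed.

(** Without a least element, every point of [J] has a rational of [J] below it, and these are
    countable; [a] serves for the other codes. *)
Lemma interval_lower_seq : exists l : nat -> [set` J],
  forall x : [set` J], exists n, set_val (l n) <= set_val x.
Proof.
have [[m mP]|nom] := pselect (exists m : [set` J],
    forall x : [set` J], set_val m <= set_val x).
  by exists (fun=> m) => x; exists 0%N.
pose l n : [set` J] :=
  if (choice.unpickle n : option rat) is Some q then insubd a (ratr q) else a.
exists l => x.
have /existsNP[y /negP] := (forallNP _).2 nom x; rewrite -ltNge => yx.
have [q] := rat_in_itvoo yx; rewrite in_itv/= => /andP[yq qx].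
have [|z zq] := @interval_valP y x (ratr q); first by rewrite !ltW.
exists (choice.pickle q).
by rewrite /l choice.pickleK -zq set_valE valKd -set_valE zq ltW.
Qed.

Lemma interval_upper_seq : exists u : nat -> [set` J],
  forall x : [set` J], exists n, set_val x <= set_val (u n).
Proof.
have [[m mP]|nom] := pselect (exists m : [set` J],
    forall x : [set` J], set_val x <= set_val m).
  by exists (fun=> m) => x; exists 0%N.
pose u n : [set` J] :=
  if (choice.unpickle n : option rat) is Some q then insubd a (ratr q) else a.
exists u => x.
have /existsNP[y /negP] := (forallNP _).2 nom x; rewrite -ltNge => yx.
have [q] := rat_in_itvoo yx; rewrite in_itv/= => /andP[yq qx].
have [|z zq] := @interval_valP x y (ratr q); first by rewrite !ltW.
exists (choice.pickle q).
by rewrite /u choice.pickleK -zq set_valE valKd -set_valE zq ltW.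
Qed.

Lemma clamp_continuous (l u : [set` J]) : exists h : R -> itv_space a,
  continuous h /\ forall t, set_val (h t) = Num.max (set_val l) (Num.min t (set_val u)).
Proof.
have /choice[h hE] t : exists x : [set` J],
    set_val x = Num.max (set_val l) (Num.min t (set_val u)).
  have [ul|lu] := leP (set_val u) (set_val l).
    (* With reversed endpoints the clamp is constantly [l], still in [J]. *)
    by exists l; rewrite max_l// ge_min ul orbT.
  apply: (@interval_valP l u).
  by rewrite le_max lexx/= ge_max (ltW lu) ge_min lexx orbT.
exists h; split => //.
apply: (@continuous_comp_initial [set` J] R R set_val).
rewrite (_ : _ \o _ = ((cst (set_val l) : R -> R^o) \max (idfun \min cst (set_val u)))).
  move=> t; apply: continuous_max; first exact: cvg_cst.
  by apply: continuous_min; [exact: cvg_id|exact: cvg_cst].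
by apply/funext => t /=; rewrite hE.
Qed.

(** Countably many segments with endpoints in [J] fill [J]; each is its own image under the clamp,
    and pairs of endpoints are coded by integers. *)
Lemma interval_segment_images : exists (h : nat -> R -> itv_space a) (l u : nat -> R),
  (forall n, continuous (h n)) /\ \bigcup_n h n @` `[l n, u n] = setT.
Proof.
have [l lP] := interval_lower_seq; have [u uP] := interval_upper_seq.
have /choice[h hP] n : exists h : R -> itv_space a, continuous h /\
    if (choice.unpickle n : option (nat * nat)) is Some mk then forall t,
      set_val (h t) = Num.max (set_val (l mk.1)) (Num.min t (set_val (u mk.2)))
    else True.
  case: (choice.unpickle n : option (nat * nat)) => [[m k]|].
    exact: clamp_continuous.
  by exists (fun=> a); split => // t; exact: cvg_cst.
pose b (v : nat * nat -> [set` J]) n :=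
  if (choice.unpickle n : option (nat * nat)) is Some mk then set_val (v mk) else 0.
exists h, (b (fun mk => l mk.1)), (b (fun mk => u mk.2)); split => [n|].
  by have [] := hP n.
apply/seteqP; split => // x _.
have [m lx] := lP x; have [k xu] := uP x.
exists (choice.pickle (m, k)) => //; exists (set_val x).
  by rewrite /b choice.pickleK/= in_itv/= lx.
have [_] := hP (choice.pickle (m, k)); rewrite choice.pickleK => /(_ (set_val x)).
by rewrite min_l// max_r// !set_valE => /val_inj.
Qed.

Lemma interval_tight : tight R (itv_space a).
Proof.
have [h [l [u [ch hT]]]] := interval_segment_images.
exact: segment_images_tight ch hT.
Qed.

Lemma interval_dense_seq : exists p : nat -> itv_space a, dense (range p).
Proof.
have [h [l [u [ch hT]]]] := interval_segment_images.
exact: segment_images_dense_seq ch hT.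
Qed.

End interval.

(** * Continuous functions on the product *)

Section separating_family.
Context (R : realType) (I : finType) (T : I -> ptopologicalType)
  (p : forall i, nat -> T i) (f : prod_topology T -> R).
Hypotheses (dp : forall i, dense (range (p i))) (cf : continuous f)
  (bf : bounded_fun f).

(** A partial function of [f], the other coordinates being frozen in the dense sequences at indices
    coded by [n]; 0 if [n] codes nothing. *)
Definition slice (i : I) (n : nat) (x : T i) : R :=
  if (choice.unpickle n : option {ffun I -> nat}) is Some z
  then f (dfwith (fun j => p j (z j)) i x) else 0.

Arguments slice : clear implicits.

Lemma Cb_slice i n : Cb R (T i) (slice i n).
Proof.
rewrite /slice; case: (choice.unpickle n : option {ffun I -> nat}) => [z|]; last first.
  split; first by move=> x; exact: cvg_cst.
  by exists 0; split => // M M0 x _ /=; rewrite normr0 ltW.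
split.
  suff cfi : continuous (f \o dfwith (fun j => p j (z j)) i) by exact: cfi.
  by move=> x; apply: continuous_comp; [exact: dfwith_continuous|exact: cf].
by have [M [Mr bM]] := bf; exists M; split => // N MN x _; exact: bM.
Qed.

Lemma dfwith_id (w : forall i, T i) i : dfwith w i (w i) = w.
Proof. by apply: functional_extensionality_dep => j; case: dfwithP. Qed.

Let f_upd (w : forall i, T i) j i (x : T i) :
  continuous (fun t => f (dfwith (dfwith w j t) i x)).
Proof.
have [ij|ij] := eqVneq i j.
  subst j; rewrite (_ : (fun t => _) = cst (f (dfwith w i x))).
    by move=> t; exact: cvg_cst.
  apply/funext => t /=; congr f; apply: functional_extensionality_dep => k.
  case: dfwithP => [|k' ik]; first by rewrite dfwithin.
  by rewrite !dfwithout.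
rewrite (_ : (fun t => _) = f \o dfwith (dfwith w i x) j).
  move=> t; apply: continuous_comp; last exact: cf.
  exact: dfwith_continuous.
apply/funext => t /=; congr f; apply: functional_extensionality_dep => k.
have [ik|ik] := eqVneq i k.
  by subst k; rewrite dfwithin dfwithout 1?eq_sym// dfwithin.
rewrite dfwithout//; have [jk|jk] := eqVneq j k; first by subst k; rewrite !dfwithin.
by rewrite !dfwithout.
Qed.

(** [x] is turned into [y] one coordinate at a time. The slices allow this when the other
    coordinates lie in the dense sequences; density and continuity do the rest. *)
Lemma slice_separates (x y : forall i, T i) :
  (forall i n, slice i n (x i) = slice i n (y i)) -> f x = f y.
Proof.
move=> xy.
(* [s] lists the coordinates where [w] is arbitrary, freed one by one. *)
have H i (s : seq I) : forall w, (forall j, j \notin s -> range (p j) (w j)) ->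
    f (dfwith w i (x i)) = f (dfwith w i (y i)).
  elim: s => [w wp|j s ih w wp].
    have /choice[z zw] j : exists n, p j n = w j.
      by have [n _ nw] := wp j isT; exists n.
    have := xy i (choice.pickle [ffun j => z j]).
    rewrite /slice choice.pickleK.
    rewrite (_ : (fun j => p j ([ffun j => z j] j)) = w)//.
    by apply: functional_extensionality_dep => j; rewrite ffunE.
  pose h t := f (dfwith (dfwith w j t) i (x i)) - f (dfwith (dfwith w j t) i (y i)).
  have ch : continuous h by move=> t; apply: cvgB; exact: f_upd.
  suff h0 : h (w j) = 0.
    by apply/eqP; rewrite -subr_eq0; move/eqP: h0; rewrite /h dfwith_id.
  apply: contrapT => h0.
  (* A nonzero value of [h] would persist on an open set, hence at a point of the dense sequence,
     against the induction hypothesis. *)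
  have [||t [ht pt]] := dp (O := h @^-1` [set r | r != 0]).
  - by exists (w j); exact/eqP.
  - by apply: open_comp; [move=> t _; exact: ch|exact: open_neq].
  move/eqP : ht; apply; apply/eqP; rewrite subr_eq0; apply/eqP.
  apply: ih => k ks; have [jk|jk] := eqVneq j k; first by subst k; rewrite dfwithin.
  by rewrite dfwithout//; apply: wp; rewrite inE negb_or eq_sym jk.
pose mix (s : seq I) j := if j \in s then y j else x j.
have <- : mix (enum I) = y.
  by apply: functional_extensionality_dep => j; rewrite /mix mem_enum.
elim: (enum I) => [|i s ->]; first by congr f; exact: functional_extensionality_dep.
have [js|js] := boolP (i \in s).
  congr f; apply: functional_extensionality_dep => j; rewrite /mix inE.
  by case: eqVneq => // ->; rewrite js.
rewrite -[mix s in LHS](dfwith_id _ i) {2}/mix (negbTE js).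
rewrite (@H i (enum I)) => [|j]; last by rewrite mem_enum.
congr f; apply: functional_extensionality_dep => j; rewrite /mix inE.
case: dfwithP => [|k ik]; first by rewrite eqxx.
by rewrite eq_sym (negbTE ik).
Qed.

End separating_family.

(** * Measurability of continuous functions up to null sets *)

Section product_cozero.
Context (R : realType) (I : finType) (T : I -> ptopologicalType)
  (mu : forall i, probability (borel (T i)) R).
Hypotheses (tT : forall i, tight R (T i))
  (dT : forall i, exists p : nat -> T i, dense (range p)).

Let X := mprod (fun i => borel (T i)).
Let Y := g_sigma_algebraType (@cozero_boxes R I T).

(** A strict superlevel set is a cozero box, given by [u - r] on factor [i] and the constant 1 on
    the others. *)
Lemma measurable_coord_cozero i (u : T i -> R) : Cb R (T i) u ->
  measurable_fun [set: Y] (fun x : Y => u (x i)).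
Proof.
move=> [cu [M [Mr bM]]]; apply: (measurability _ (RGenOInfty.measurableE R)).
move=> _ [_ [r ->] <-]; rewrite setTI; apply: sub_sigma_algebra.
exists (dfwith (fun j : I => cst 1 : T j -> R) i (fun x => u x - r)).
  move=> j; case: dfwithP => [|k ik].
    split; first by move=> x; apply: cvgB; [exact: cu|exact: cvg_cst].
    exists (M + `|r|); split; first by rewrite num_real.
    move=> N; rewrite -ltrBrDr => /bM bN x _ /=.
    by rewrite (le_trans (ler_normB _ _))// -lerBrDr bN.
  split; first by move=> x; exact: cvg_cst.
  by exists 1; split => // N N1 x _ /=; rewrite normr1 ltW.
apply/seteqP; split => x /=; rewrite in_itv/= andbT.
  move=> rx j; have [ij|ij] := eqVneq i j; last by rewrite dfwithout//= ltr01.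
  by subst j; rewrite dfwithin subr_gt0.
by move=> /(_ i); rewrite dfwithin subr_gt0.
Qed.

Section saturated.
Variables (e : forall i, nat -> T i -> R).
Hypothesis Ce : forall i n, Cb R (T i) (@e i n).

Definition coord_fun (n : nat) (x : prod_topology T) : R :=
  if (choice.unpickle n : option (I * nat)) is Some (i, m) then e m (x i) else 0.

Lemma continuous_coord_fun n : continuous (coord_fun n).
Proof.
rewrite /coord_fun; case: (choice.unpickle n : option (I * nat)) => [[i m]|]; last first.
  by move=> x; exact: cvg_cst.
move=> x; apply: (@continuous_comp (prod_topology T) _ _ (fun y => y i) (@e i m)).
  exact: proj_continuous.
exact: (Ce i m).1.
Qed.

Lemma measurable_coord_fun n : measurable_fun [set: Y] (coord_fun n).
Proof.
rewrite /coord_fun; case: (choice.unpickle n : option (I * nat)) => [[i m]|//].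
exact: measurable_coord_cozero.
Qed.

Lemma coord_fun_eq (x y : forall i, T i) :
  (forall n, coord_fun n x = coord_fun n y) <-> forall i n, e n (x i) = e n (y i).
Proof.
split=> xy; last by move=> n; rewrite /coord_fun; case: (choice.unpickle n) => [[i m]|].
by move=> i n; have := xy (choice.pickle (i, n)); rewrite /coord_fun choice.pickleK.
Qed.

(** Each [coord_fun] tests a single coordinate, so representatives are chosen factor by factor. The
    saturation of a box is then a box, whose product mass is known. *)
Lemma saturation_prod (K : forall i, set (T i)) :
  saturation coord_fun [set x | forall i, K i (x i)] =
  [set x | forall i, saturation (@e i) (K i) (x i)].
Proof.
apply/seteqP; split => x.
  by move=> [y Ky /coord_fun_eq xy] i; exists (y i) => // n; exact: xy.
move=> Kx.
have yP i : exists y, K i y /\ forall n, e n (x i) = e n y.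
  by have [y Ky xy] := Kx i; exists y.
exists (fun i => sval (cid (yP i))); last apply/coord_fun_eq => i n.
  by move=> i; case: cid => y []//.
by case: cid => y [_] /=.
Qed.

(* [mu (saturation e K)] is the limit of the masses of open neighbourhoods of [K]. *)
Lemma tight_saturation i (eps : R) : 0 < eps -> exists K : set (T i), compact K /\
  ((1 - eps)%:E <= mu i (saturation (@e i) K))%E.
Proof.
move=> eps0; have [K [cK KU]] := tT (mu i) eps0; exists K; split => //.
have ce n : continuous (@e i n) by exact: (Ce i n).1.
have mV n : measurable (saturation_nbhd (@e i) K n : set (borel (T i))).
  by apply: sub_sigma_algebra; exact: open_saturation_nbhd.
rewrite -bigcap_saturation_nbhd//.
have mu_fin : (mu i (saturation_nbhd (@e i) K 0) < +oo)%E.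
  by rewrite (le_lt_trans (probability_le1 _ _))// ltry.
have cvV := nonincreasing_cvg_mu mu_fin mV (bigcapT_measurable mV)
  (@nonincreasing_saturation_nbhd _ _ (@e i) K).
apply: (cvge_ge _ cvV).
apply: nearW => n /=; apply: KU; first exact: open_saturation_nbhd.
by move=> x Kx; apply: sub_saturation_nbhd; exact: sub_saturation.
Qed.

End saturated.

Lemma continuous_ae_cozero (f : prod_topology T -> R) : continuous f -> bounded_fun f ->
  exists B : set (forall i, T i), [/\ <<s @cozero_boxes R I T >> B,
    mprod_prob mu B = 1%E & measurable_fun [set: Y] (f \_ B)].
Proof.
move=> cf bf; pose p i := sval (cid (dT i)).
have dp i : dense (range (p i)) by rewrite /p; case: cid.
pose e i n := slice p f i n.
have Ce i n : Cb R (T i) (e i n) by exact: Cb_slice.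
have f_sep (x y : forall i, T i) :
    (forall n, coord_fun e n x = coord_fun e n y) -> f x = f y.
  by move/coord_fun_eq; exact: slice_separates.
have eps0 n : 0 < n.+1%:R^-1 :> R by rewrite invr_gt0.
pose K i n := sval (cid (tight_saturation Ce i (eps0 n))).
have cK i n : compact (K i n) by rewrite /K; case: cid => ? [].
pose S i n := saturation (e i) (K i n).
have mS i n : measurable (S i n : set (borel (T i))).
  apply: (@measurable_saturation _ _ _ _ _ (borel (T i)) idfun) => //.
    by move=> m; exact: (Ce i m).1.
  by move=> m; apply: continuous_measurable_borel; exact: (Ce i m).1.
pose B_ i := \bigcup_n S i n.
have mB_ i : measurable (B_ i : set (borel (T i))) by exact: bigcupT_measurable.
have B_1 i : mu i (B_ i) = 1%E.
  apply/eqP; rewrite eq_le (probability_le1 _ (mB_ i))/=; apply/lee_addgt0Pr => r r0.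
  have [n _ /(_ n (leqnn n))/= nr] := near_infty_natSinv_lt (PosNum r0).
  rewrite -leeBlDr// -EFinB (@le_trans _ _ (1 - n.+1%:R^-1)%:E)//.
    by rewrite lee_fin lerB// ltW.
  apply: (@le_trans _ _ (mu i (S i n))).
    by rewrite /S /K; case: cid => ? [].
  by apply: le_measure; rewrite ?mem_set//; exact: bigcup_sup.
(* One compact set per factor: the box is compact by Tychonoff's theorem, and there are countably
   many such [z]. *)
pose C (z : {ffun I -> nat}) : set (prod_topology T) :=
  [set x | forall i, K i (z i) (x i)].
have cC z : compact (C z).
  exact: (@tychonoff I T (fun i => K i (z i)) (fun i => cK i (z i))).
have mC (A : set (prod_topology T)) : compact A ->
    measurable (saturation (coord_fun e) A : set Y).
  move=> cA.
  have := @measurable_saturation R (prod_topology T) (coord_fun e)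
    (continuous_coord_fun Ce) _ Y idfun A.
  by apply=> // n; exact: measurable_coord_fun.
pose B : set (forall i, T i) := [set x | forall i, B_ i (x i)].
have CE z : saturation (coord_fun e) (C z) = [set x | forall i, S i (z i) (x i)].
  exact: (@saturation_prod e (fun i => K i (z i))).
have BE : B = \bigcup_z saturation (coord_fun e) (C z).
  apply/seteqP; split => x.
    move=> Bx; have nP i : exists n, S i n (x i) by have [n _] := Bx i; exists n.
    exists [ffun i => sval (cid (nP i))] => //; rewrite CE => i.
    by rewrite ffunE; case: cid.
  by move=> [z _]; rewrite CE => Sx i; exists (z i) => //; exact: Sx.
have mB : measurable (B : set Y).
  rewrite BE; apply: countable_bigcupT_measurable => [|z]; first exact: countableP.
  exact: mC.
exists B; split => //.
  rewrite (@mprod_probE I _ (fun i => borel (T i)) R _ B_)//.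
  by rewrite big1.
apply/(measurable_restrictT _ mB).
apply: (measurability _ (RGenCInfty.measurableE R)).
move=> _ [_ [c ->] <-].
(* By [f_sep], [f] is constant on fibres, so saturating a piece where [f] is at least [c] adds no
   point where it is smaller. *)
rewrite (_ : _ `&` _ =
  \bigcup_z saturation (coord_fun e) (C z `&` f @^-1` [set r | c <= r])).
  apply: countable_bigcupT_measurable => [|z]; first exact: countableP.
  apply: mC; apply: compact_closedI => //.
  by apply: closed_comp; [move=> x _; exact: cf|exact: closed_ge].
rewrite BE; apply/seteqP; split => x.
  move=> [[z _ [y Cy xy]]]; rewrite /= in_itv/= andbT (f_sep _ _ xy) => cy.
  by exists z => //; exists y.
move=> [z _ [y [Cy cy] xy]]; split; first by exists z => //; exists y.
by rewrite /= in_itv/= andbT (f_sep _ _ xy).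
Qed.

End product_cozero.

(** Shared by Suslin factors and intervals, which enter through tightness and a dense sequence
    only. *)
Theorem product_barycenter (R : realType) (I : finType) (T : I -> ptopologicalType)
    (d : I -> measure_display) (S : forall i, measurableType (d i))
    (kappa : forall i, S i -> probability (borel (T i)) R)
    (mu : forall i, probability (borel (T i)) R)
    (nu : forall i, probability (S i) R) :
  (forall i, tight R (T i)) ->
  (forall i, exists p : nat -> T i, dense (range p)) ->
  (forall i u, Cb R (T i) u ->
    measurable_fun setT (fun s : S i => \int[kappa i s]_x (u x)%:E)%E) ->
  (forall i, barycenter (mu i) (nu i) (kappa i) (Cb R (T i))) ->
  barycenter (mprod_prob mu) (mprod_prob nu)
    (fun s : mprod S => mprod_prob (fun i => kappa i (s i)))
    (Cb R (prod_topology T)).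
Proof.
move=> tT dT mkappa bary f [cf bf].
have [B [sB B1 mfB]] := continuous_ae_cozero mu tT dT cf bf.
set K := fun s : mprod S => mprod_prob (fun i => kappa i (s i)).
pose X := mprod (fun i => borel (T i)).
have mB : measurable (B : set X) by exact: sub_cozero_boxes sB.
have mg : measurable_fun [set: X] (EFin \o (f \_ B)).
  apply/measurable_EFinP => _ A mA; rewrite setTI; apply: sub_cozero_boxes.
  by have := mfB measurableT A mA; rewrite setTI; exact.
have B0 : mprod_prob mu (~` B) = 0%E by rewrite probability_setC// B1 subee.
have fgE (m : probability X R) : m (~` B) = 0%E ->
    (\int[m]_x (f x)%:E = \int[m]_x ((f \_ B) x)%:E)%E.
  move=> m0; apply: (@ae_eq_integral_nomeas _ _ _ m B) => // x Bx.
  by rewrite patchE mem_set.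
have bg : bounded_fun (f \_ B).
  have [M [Mr bM]] := bf; exists M; split => // N MN x _.
  rewrite /= patchE; case: ifPn => _; first exact: bM.
  by rewrite normr0 (le_trans (normr_ge0 _) (bM _ MN x Logic.I)).
transitivity (\int[mprod_prob mu]_x ((f \_ B) x)%:E)%E; first exact: fgE.
transitivity (\int[mprod_prob nu]_s \int[K s]_x ((f \_ B) x)%:E)%E.
  exact: esym (barycenter_bounded_cozero mkappa bary mfB bg).
have sBC : <<s @cozero_boxes R I T>> (~` B).
  exact: (@measurableC _ (g_sigma_algebraType (@cozero_boxes R I T))).
have [mKB KB] := barycenter_cozero_boxes mkappa bary sBC.
(* The mean over [s] of the mass that [K s] gives to the complement of [B] is the mass under the
   product of the [mu i], which is 0; hence [Z] has full measure. *)
pose Z := [set s | K s (~` B) = 0%E].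
have mZ : measurable Z.
  by have := mKB measurableT _ (emeasurable_set1 0%E); rewrite setTI.
apply/esym/(@ae_eq_integral_nomeas _ _ _ _ Z) => //.
- apply/negligibleP; first exact: measurableC.
  have : (\int[mprod_prob nu]_s `|K s (~` B)| = 0)%E.
    by rewrite -[RHS]B0 -KB; apply: eq_integral => s _; rewrite gee0_abs.
  move=> /(ae_eq_integral_abs _ measurableT mKB) aeK.
  by apply: negligibleS aeK => s /= nZ /(_ Logic.I).
- exact: (measurable_integral_cozero mkappa bary mfB).
- by move=> s; exact: fgE.
Qed.

(** * Weak topology and application to the moment classes *)

Lemma Cb_integral_fin_num (R : realType) (T : ptopologicalType)
    (m : probability (borel T) R) (u : T -> R) : Cb R T u ->
  (\int[m]_x (u x)%:E)%E \is a fin_num.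
Proof.
move=> [cu bu]; have : m.-integrable setT (EFin \o u); last exact: integrable_fin_num.
apply: measurable_bounded_integrable => //.
- by rewrite (le_lt_trans (probability_le1 _ _))// ltry.
- exact: continuous_measurable_borel.
Qed.

(** The weak topology makes the integral continuous on [prob R T], hence Borel on the subspace
    [A]. *)
Lemma measurable_integral_prob (R : realType) (T : ptopologicalType)
    (A : set (prob R T)) (s0 : A) (u : T -> R) : Cb R T u ->
  measurable_fun setT (fun s : borel (based s0) =>
    (\int[(set_val s : probability (borel T) R)]_x (u x)%:E)%E).
Proof.
move=> Cu; pose U : set_type (Cb R T) := SigSub (mem_set Cu).
apply: (eq_measurable_fun (fun s : borel (based s0) =>
    (prob_ev (set_val s : probability (borel T) R) U)%:E)).
  by move=> s _; rewrite /prob_ev /Rintegral fineK//; exact: Cb_integral_fin_num.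
apply/measurable_EFinP.
apply: continuous_measurable_borel.
suff c : continuous (fun s : A => prob_ev (set_val s : probability (borel T) R) U).
  exact: c.
move=> s; apply: (@continuous_comp A (prob R T) R set_val (fun m => prob_ev m U)).
  exact: initial_continuous.
move=> m; apply: (@continuous_comp (prob R T) {ptws set_type (Cb R T) -> R} R
  (@prob_ev R T) (fun g => g U)); first exact: initial_continuous.
exact: proj_continuous.
Qed.

Theorem proposition3p3 (R : realType) (p q : nat)
    (X : 'I_p -> ptopologicalType) (J : 'I_q -> interval R)
    (a : forall k, [set` J k]) (N : 'I_p + 'I_q -> nat)
    (phi : forall i : 'I_p + 'I_q, 'I_(N i) -> borel (factor_space X a i) -> R)
    (suslinX : forall k, suslin R (X k))
    (mphi : forall i j, measurable_fun [set: borel (factor_space X a i)] (@phi i j))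
    (representation :
      forall (i : 'I_p + 'I_q) (mu : probability (borel (factor_space X a i)) R),
        moment_class phi i mu ->
        exists (s0 : finite_mixtures phi i)
               (nu : probability (borel (based s0)) R),
          barycenter mu nu (fun s : finite_mixtures phi i => set_val s)
            (Cb R (factor_space X a i))) :
  forall mu : forall i, probability (borel (factor_space X a i)) R,
    (forall i, moment_class phi i (mu i)) ->
    exists (s0 : forall i, finite_mixtures phi i)
           (nu : probability (mprod (fun i => borel (based (s0 i)))) R),
      barycenter (mprod_prob mu) nu
        (fun s : forall i, finite_mixtures phi i =>
           mprod_prob (fun i => set_val (s i)))
        (Cb R (prod_topology (factor_space X a))).
Proof.
move=> mu Amu.
(* The hypothesis yields, together with the law [nu i], the base point [s0 i] of the space that
   carries it. *)
pose s0 i := sval (cid (representation i (mu i) (Amu i))).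
pose nu i : probability (borel (based (s0 i))) R :=
  sval (cid (svalP (cid (representation i (mu i) (Amu i))))).
have bary i : barycenter (mu i) (nu i) (fun s : borel (based (s0 i)) => set_val s)
    (Cb R (factor_space X a i)).
  exact: (svalP (cid (svalP (cid (representation i (mu i) (Amu i)))))).
exists s0, (mprod_prob nu).
apply: (@product_barycenter R _ (factor_space X a) _ (fun i => borel (based (s0 i)))
  (fun i s => set_val s) mu nu) => //.
- by move=> [k|k]; [exact: suslin_tight (suslinX k)|exact: interval_tight].
- by move=> [k|k]; [exact: suslin_dense_seq (suslinX k)|exact: interval_dense_seq].
move=> i u Cu; exact: measurable_integral_prob.
Qed.
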